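(* Let $0\le\epsilon\le1$ and let $\mathcal{A}$ be an $\alpha$-approximation algorithm for MAX-SAT. Given a MAX-SAT instance and subset advice $S$ with parameter $\epsilon$ (with respect to a fixed optimal assignment $x^*$), consider the procedure: (1) set the variables indexed by $S$ to their advised values, count the clauses thereby satisfied, and remove satisfied clauses and false literals; (2) run $\mathcal{A}$ on the reduced instance to assign the remaining variables. Then this procedure is an $(\alpha+(1-\alpha)\epsilon)$-approximation, i.e. the expected number (over the advice) of clauses satisfied is at least $(\alpha+(1-\alpha)\epsilon)\cdot\mathrm{OPT}$. In particular, using an algorithm with $\alpha\ge0.796$ (such as the one of Avidor, Berkovitch and Zwick), the approximation ratio for MAX-SAT is at least $0.796+0.204\epsilon$.
   Context: MAX-SAT: given a CNF formula with $m$ clauses over $n$ Boolean variables, find an assignment maximizing the number of satisfied clauses; $\mathrm{OPT}$ denotes this maximum. An $\alpha$-approximation algorithm returns an assignment satisfying at least $\alpha$ times the optimum number of satisfiable clauses of its input instance. Subset advice with parameter $\epsilon$: a random set $S\subseteq\{1,\dots,n\}$, each index included independently with probability $\epsilon$, together with $\{x^*_i\}_{i\in S}$ for a fixed optimal assignment $x^*$. *)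

(* Defs.v *)
From mathcomp Require Import all_boot all_order all_algebra.

Set Implicit Arguments.
Unset Strict Implicit.
Unset Printing Implicit Defensive.

Import Order.TTheory GRing.Theory Num.Theory.
Local Open Scope ring_scope.

(* The literal x_i is [(i, true)] and its negation is [(i, false)]. *)
Definition clause (n : nat) : Type := {set 'I_n * bool}.

(* A sequence, since identical clauses are counted with multiplicity (the
   reduction below may create duplicates as well as empty clauses). *)
Definition formula (n : nat) : Type := seq (clause n).

Definition assignment (n : nat) : Type := {ffun 'I_n -> bool}.

Definition clause_sat (n : nat) (x : assignment n) (c : clause n) : bool :=
  [exists l in c, x l.1 == l.2].

Definition num_sat (n : nat) (phi : formula n) (x : assignment n) : nat :=
  count (clause_sat x) phi.

Definition OPT (n : nat) (phi : formula n) : nat :=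
  \max_(x : {ffun 'I_n -> bool}) num_sat phi x.

Definition optimal (n : nat) (phi : formula n) (x : assignment n) : Prop :=
  num_sat phi x = OPT phi.

Definition algorithm : Type := forall n : nat, formula n -> assignment n.

Definition approximation (R : realFieldType) (alpha : R) (A : algorithm) :
    Prop :=
  forall (n : nat) (phi : formula n),
    alpha * (OPT phi)%:R <= (num_sat phi (A n phi))%:R.

(* Advice is a partial assignment: [Some b] at the advised indices, [None] at
   the others.  A procedure taking such an argument has no access to the values
   of the optimal assignment outside the advised set. *)
Definition advice (n : nat) : Type := {ffun 'I_n -> option bool}.

Definition advice_algorithm : Type :=
  forall n : nat, formula n -> advice n -> assignment n.

Definition subset_advice (n : nat) (x : assignment n) (S : {set 'I_n}) :
    advice n :=
  [ffun i => if i \in S then Some (x i) else None].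

Definition free_vars (n : nat) (p : advice n) : {set 'I_n} :=
  [set i | p i == None].

Definition advice_sat (n : nat) (p : advice n) (c : clause n) : bool :=
  [exists l in c, p l.1 == Some l.2].

(* The k-th variable of the reduced instance is the k-th free variable,
   [enum_val k].  In a clause not satisfied by the advice, the false literals
   are exactly those on advised variables, so the literals on free variables
   are the ones that remain. *)
Definition reduce_clause (n : nat) (p : advice n) (c : clause n) :
    clause #|free_vars p| :=
  [set l : 'I_#|free_vars p| * bool | (enum_val l.1, l.2) \in c].

Definition reduce (n : nat) (phi : formula n) (p : advice n) :
    formula #|free_vars p| :=
  [seq reduce_clause p c | c <- phi & ~~ advice_sat p c].

(* A free variable [i] gets the value [y k] for the unique [k] such that
   [enum_val k = i]. *)
Definition extend (n : nat) (p : advice n) (y : assignment #|free_vars p|) :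
    assignment n :=
  [ffun i => if p i is Some b then b
             else [exists k, (enum_val k == i) && y k]].

Definition with_advice (A : algorithm) : advice_algorithm :=
  fun n phi p => extend (A #|free_vars p| (reduce phi p)).

(* The law of the random set containing each index independently with
   probability [eps]. *)
Definition subset_prob (R : realFieldType) (n : nat) (eps : R)
    (S : {set 'I_n}) : R :=
  \prod_(i < n) (if i \in S then eps else 1 - eps).

Definition subset_expectation (R : realFieldType) (n : nat) (eps : R)
    (f : {set 'I_n} -> R) : R :=
  \sum_(S : {set 'I_n}) subset_prob eps S * f S.

Definition subset_advice_approximation (R : realFieldType) (eps rho : R)
    (B : advice_algorithm) : Prop :=
  forall (n : nat) (phi : formula n) (x : assignment n),
    optimal phi x ->
    rho * (OPT phi)%:R <=
    subset_expectation eps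
      (fun S => (num_sat phi (B n phi (subset_advice x S)))%:R).

(* Main.v *)
Require Import Defs.
From mathcomp Require Import all_boot all_order all_algebra.
From mathcomp Require Import lra.

Set Implicit Arguments.
Unset Strict Implicit.
Unset Printing Implicit Defensive.

Import Order.TTheory GRing.Theory Num.Theory.
Local Open Scope ring_scope.

(** A clause satisfied by [x*] contains a literal true under [x*], whose
    variable is advised with probability [eps]; so the number [a] of clauses
    satisfied by the advice has expectation at least [eps * OPT].  Restricting
    [x*] to the free variables shows that the reduced instance has optimum at
    least [OPT - a], so the procedure satisfies at least
    [a + alpha (OPT - a) = alpha OPT + (1 - alpha) a] clauses. *)

Lemma num_sat_le_OPT n (phi : formula n) (x : assignment n) :
  (num_sat phi x <= OPT phi)%N.
Proof. exact: (leq_bigmax (F := num_sat phi)). Qed.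

Section Reduction.
Variables (n : nat) (p : advice n).

Lemma extend_enum_val (y : assignment #|free_vars p|) k :
  extend y (enum_val k) = y k.
Proof.
have /[!inE]/eqP pk := enum_valP k.
rewrite ffunE pk; apply/existsP/idP => [[j /andP[/eqP/enum_val_inj -> //]]|yk].
by exists k; rewrite eqxx.
Qed.

Lemma extend_advised (y : assignment #|free_vars p|) i b :
  p i = Some b -> extend y i = b.
Proof. by rewrite ffunE => ->. Qed.

(** A true literal of [c] sits either on an advised variable, where the advice alone makes it true,
    or on a free one, where it survives in the reduced clause. *)
Lemma clause_sat_extend (y : assignment #|free_vars p|) (c : clause n) :
  clause_sat (extend y) c = advice_sat p c || clause_sat y (reduce_clause p c).
Proof.
apply/existsP/orP => [[[i b] /= /andP[ic /eqP xi]]|[]].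
- case pi: (p i) => [b'|].
    left; apply/existsP; exists (i, b); rewrite /= ic pi.
    by rewrite -xi (extend_advised y pi) eqxx.
  have iF : i \in free_vars p by rewrite inE pi.
  right; apply/existsP; exists (enum_rank_in iF i, b).
  by rewrite inE /= -extend_enum_val enum_rankK_in // ic xi eqxx.
- case/existsP=> [[i b] /= /andP[ic /eqP pi]].
  by exists (i, b); rewrite ic /= (extend_advised y pi) eqxx.
- case/existsP=> [[k b]] /=; rewrite inE /= => /andP[kc yk].
  by exists (enum_val k, b); rewrite kc /= extend_enum_val.
Qed.

Lemma num_sat_extend (phi : formula n) (y : assignment #|free_vars p|) :
  num_sat phi (extend y) =
  (count (advice_sat p) phi + num_sat (reduce phi p) y)%N.
Proof.
rewrite /num_sat /reduce; elim: phi => //= c phi ->.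
by rewrite clause_sat_extend; case: (advice_sat p c) => /=; [
  rewrite addnA | rewrite addnCA].
Qed.

End Reduction.

(** Presents [x] as an [extend], so that [num_sat_extend] also splits the count of an optimal
    assignment. *)
Lemma extend_subset_advice n (x : assignment n) (S : {set 'I_n}) :
  extend [ffun k : 'I_#|free_vars (subset_advice x S)| => x (enum_val k)] = x.
Proof.
apply/ffunP => i; case: (boolP (i \in S)) => iS.
  by apply: extend_advised; rewrite ffunE iS.
have iF : i \in free_vars (subset_advice x S) by rewrite inE ffunE (negPf iS).
by rewrite -(enum_rankK_in iF iF) extend_enum_val ffunE.
Qed.

Lemma OPT_le_reduce n (phi : formula n) (x : assignment n) (S : {set 'I_n}) :
  optimal phi x ->
  (OPT phi <= count (advice_sat (subset_advice x S)) phi +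
              OPT (reduce phi (subset_advice x S)))%N.
Proof.
move=> <-; rewrite -[X in num_sat _ X](extend_subset_advice x S).
by rewrite num_sat_extend leq_add2l; apply: num_sat_le_OPT.
Qed.

Section Approximation.
Variables (R : realFieldType) (alpha : R) (A : algorithm).
Hypothesis A_approx : approximation alpha A.

(** Makes [1 - alpha] nonnegative, so that a lower bound on the expected advice count can be
    multiplied by it. *)
Lemma approximation_le1 : alpha <= 1.
Proof.
(* The clause x_0 \/ ~ x_0 is satisfied by every assignment. *)
pose phi : formula 1 := [:: setT].
have sat1 x : num_sat phi x = 1%N.
  rewrite /num_sat /= addn0; apply/eqP; rewrite eqb1.
  by apply/existsP; exists (ord0, x ord0); rewrite inE /=.
have OPT1 : OPT phi = 1%N.
  apply/anti_leq/andP; split; first by apply/bigmax_leqP => x _; rewrite sat1.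
  by have := num_sat_le_OPT phi [ffun=> true]; rewrite sat1.
by have := A_approx phi; rewrite sat1 OPT1 mulr1.
Qed.

(** This bound holds for each [S] separately and is affine in the advice count, so only the
    expectation of that count remains to be estimated. *)
Lemma num_sat_with_advice_ge n (phi : formula n) (x : assignment n)
    (S : {set 'I_n}) :
  optimal phi x ->
  alpha * (OPT phi)%:R
    + (1 - alpha) * (count (advice_sat (subset_advice x S)) phi)%:R <=
  (num_sat phi (with_advice A phi (subset_advice x S)))%:R.
Proof.
move=> opt_x; rewrite num_sat_extend natrD.
have := A_approx (reduce phi (subset_advice x S)).
have := OPT_le_reduce S opt_x; rewrite -(ler_nat R) natrD.
have : (count (advice_sat (subset_advice x S)) phi)%:R <= (OPT phi)%:R :> R.
  rewrite -opt_x -(extend_subset_advice x S) num_sat_extend.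
  by rewrite ler_nat extend_subset_advice leq_addr.
have := ler0n R (num_sat (reduce phi (subset_advice x S))
  (A (reduce phi (subset_advice x S)))).
set N := (num_sat _ _)%:R; set O' := (OPT (reduce _ _))%:R.
set O := (OPT _)%:R; set a := (count _ _)%:R.
(* The goal amounts to [alpha * (O - a) <= N]. For [alpha >= 0] it follows from [O - a <= O'] and
   the guarantee of [A]; for [alpha <= 0] the left side is nonpositive, since [a <= O]. *)
move=> N_ge0 aO OaO' AN; have [alpha_ge0|/ltW alpha_le0] := leP 0 alpha.
  by have := ler_wpM2l alpha_ge0 OaO'; rewrite mulrDr; lra.
have : alpha * (O - a) <= 0 by rewrite mulr_le0_ge0 // subr_ge0.
by rewrite mulrBr; lra.
Qed.

End Approximation.

Section Expectation.
Variables (R : realFieldType) (n : nat) (eps : R).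
Implicit Types (f g : {set 'I_n} -> R) (S : {set 'I_n}).

Lemma sum_subset_prob : \sum_(S : {set 'I_n}) subset_prob eps S = 1.
Proof.
rewrite /subset_prob -bigA_distr.
by rewrite big1 // => i _ /=; rewrite addrC subrK.
Qed.

Lemma sum_subset_prob_mem (i : 'I_n) :
  \sum_(S : {set 'I_n} | i \in S) subset_prob eps S = eps.
Proof.
(* Expanding this product over subsets, the zero at [j = i] kills exactly the terms of the sets that
   miss [i]. Factor by factor, it is [eps] at [i] and 1 elsewhere. *)
transitivity (\prod_(j < n) (eps + (if j == i then 0 else 1 - eps))).
  rewrite bigA_distr big_mkcond; apply: eq_bigr => S _.
  case: ifPn => iS.
    apply: eq_bigr => j _; case: ifPn => // jS.
    by case: eqP => // ji; rewrite ji iS in jS.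
  by rewrite (bigD1 i) //= (negPf iS) eqxx mul0r.
rewrite (bigD1 i) //= eqxx addr0 big1 ?mulr1 // => j /negPf ->.
by rewrite addrC subrK.
Qed.

Hypotheses (eps_ge0 : 0 <= eps) (eps_le1 : eps <= 1).

Lemma subset_prob_ge0 S : 0 <= subset_prob eps S.
Proof. by apply: prodr_ge0 => i _; case: ifP => _ //; rewrite subr_ge0. Qed.

Lemma ler_subset_expectation f g :
  (forall S, f S <= g S) ->
  subset_expectation eps f <= subset_expectation eps g.
Proof.
by move=> fg; apply: ler_sum => S _; rewrite ler_wpM2l ?subset_prob_ge0.
Qed.

Lemma subset_expectation_affine (a b : R) f :
  subset_expectation eps (fun S => a + b * f S) =
  a + b * subset_expectation eps f.
Proof.
rewrite /subset_expectation; under eq_bigr do rewrite mulrDr mulrCA.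
by rewrite big_split /= -mulr_suml sum_subset_prob mul1r -mulr_sumr.
Qed.

Lemma subset_expectation_advice_sat (x : assignment n) (c : clause n) :
  eps * (clause_sat x c)%:R <=
  subset_expectation eps (fun S => (advice_sat (subset_advice x S) c)%:R).
Proof.
case: (boolP (clause_sat x c)) => [/existsP[[i b] /= /andP[ic xi]]|_]; last first.
  by rewrite mulr0 sumr_ge0 // => S _; rewrite mulr_ge0 ?subset_prob_ge0.
(* Writing [eps] as the total probability of the sets containing [i] allows a comparison set by set:
   each such set reveals the true literal [(i, b)]. *)
rewrite mulr1 -{1}(sum_subset_prob_mem i) big_mkcond; apply: ler_sum => S _.
case: ifPn => iS; last by rewrite mulr_ge0 ?subset_prob_ge0.
suff -> : advice_sat (subset_advice x S) c by rewrite mulr1.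
by apply/existsP; exists (i, b); rewrite ic ffunE iS /= (eqP xi).
Qed.

(** Linearity of expectation, by induction on the clauses; no independence between clauses is
    involved. *)
Lemma subset_expectation_count_advice_sat (phi : formula n)
    (x : assignment n) :
  eps * (num_sat phi x)%:R <=
  subset_expectation eps
    (fun S => (count (advice_sat (subset_advice x S)) phi)%:R).
Proof.
rewrite /num_sat; elim: phi => [|c phi IH] /=.
  by rewrite mulr0 sumr_ge0 // => S _; rewrite mulr_ge0 ?subset_prob_ge0.
rewrite natrD mulrDr.
apply: le_trans (lerD (subset_expectation_advice_sat x c) IH) _.
rewrite /subset_expectation -big_split /=.
by apply: ler_sum => S _; rewrite natrD mulrDr.
Qed.

End Expectation.

Lemma with_advice_approximation (R : realFieldType) (eps alpha : R)
    (A : algorithm) :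
  0 <= eps -> eps <= 1 -> approximation alpha A ->
  subset_advice_approximation eps (alpha + (1 - alpha) * eps) (with_advice A).
Proof.
move=> eps_ge0 eps_le1 A_approx n phi x opt_x.
apply: le_trans (ler_subset_expectation eps_ge0 eps_le1
  (fun S => num_sat_with_advice_ge A_approx S opt_x)).
rewrite subset_expectation_affine mulrDl lerD2l -mulrA ler_wpM2l //.
  by rewrite subr_ge0 (approximation_le1 A_approx).
by rewrite -opt_x subset_expectation_count_advice_sat.
Qed.

Theorem mainTheorem5 (R : realFieldType) (eps alpha : R) (A : algorithm)
    (eps_ge0 : 0 <= eps) (eps_le1 : eps <= 1)
    (A_approx : approximation alpha A) :
  subset_advice_approximation eps (alpha + (1 - alpha) * eps) (with_advice A) /\
  (796 / 1000 <= alpha ->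
   subset_advice_approximation eps (796 / 1000 + 204 / 1000 * eps)
     (with_advice A)).
Proof.
have main := with_advice_approximation eps_ge0 eps_le1 A_approx.
split=> // alpha_ge n phi x opt_x; apply: le_trans (main n phi x opt_x).
rewrite ler_wpM2r //.
(* This product is exactly the difference of the two ratios. *)
have : 0 <= (alpha - 796 / 1000) * (1 - eps) by rewrite mulr_ge0 // subr_ge0.
rewrite mulrBr mulrBl mulr1; lra.
Qed.
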